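(* Let $n\ge2$ and $k\ge1$ be integers. Then \[ \gamma_{[k]R}(C_7\Box P_n)\le\begin{cases}(n+1)(k+1)+\frac{n-1}{2}(k+1)+2k,& n\text{ odd},\\[2pt] n(k+1)+\frac n2(k+1)+2k+1,& n\text{ even}.\end{cases} \]
   Context: For a graph $G$ and $v\in V(G)$, $N(v)$ is the open neighborhood and $N[v]=N(v)\cup\{v\}$. For an integer $k\ge1$, a function $f:V(G)\to\{0,1,\dots,k+1\}$ is a $[k]$-Roman dominating function if for every vertex $v$ with $f(v)<k$ we have $\sum_{u\in N[v]}f(u)\ge k+|\{u\in N(v): f(u)>0\}|$. The weight of $f$ is $\sum_{v}f(v)$, and $\gamma_{[k]R}(G)$ is the minimum weight of a $[k]$-Roman dominating function on $G$. $C_m\Box P_n$ is the Cartesian product of the cycle $C_m$ (vertices $0,\dots,m-1$ mod $m$) and the path $P_n$ (vertices $0,\dots,n-1$): $(i,j)\sim(i',j')$ iff ($i=i'$ and $|j-j'|=1$) or ($j=j'$ and $i'\equiv i\pm1 \pmod m$). *)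

(* Defs.v *)
From mathcomp Require Import all_boot.

Set Implicit Arguments.
Unset Strict Implicit.
Unset Printing Implicit Defensive.

(* A graph on a finite type [T] is given by its adjacency relation [e : rel T]. *)

Definition open_nbh (T : finType) (e : rel T) (v : T) : {set T} :=
  [set u | e v u].

Definition closed_nbh (T : finType) (e : rel T) (v : T) : {set T} :=
  v |: open_nbh e v.

(* Labels range over {0, ..., k+1} = 'I_(k+2). *)
Definition kRoman_dominating (T : finType) (e : rel T) (k : nat)
    (f : {ffun T -> 'I_k.+2}) : bool :=
  [forall v, (f v < k) ==>
    (k + #|[set u in open_nbh e v | 0 < f u]| <= \sum_(u in closed_nbh e v) f u)].

Definition weight (T : finType) (k : nat) (f : {ffun T -> 'I_k.+2}) : nat :=
  \sum_v f v.

(* The constant function k+1 seeds [arg min]; it is always [k]-Roman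
   dominating (see [kRoman_dominating_max]), so the minimum is attained. *)
Definition kRoman_number (T : finType) (e : rel T) (k : nat) : nat :=
  weight [arg min_(f < [ffun=> ord_max] | @kRoman_dominating T e k f) weight f].

Definition cycle_adj (m : nat) : rel 'I_m :=
  fun i j => (j == i + 1 %[mod m]) || (i == j + 1 %[mod m]).

Definition path_adj (n : nat) : rel 'I_n :=
  fun i j => (j == i + 1 :> nat) || (i == j + 1 :> nat).

Definition cartesian_adj (T1 T2 : finType) (e1 : rel T1) (e2 : rel T2) :
    rel (T1 * T2) :=
  fun x y => ((x.1 == y.1) && e2 x.2 y.2) || ((x.2 == y.2) && e1 x.1 y.1).

Lemma kRoman_dominating_max (T : finType) (e : rel T) (k : nat) :
  kRoman_dominating e [ffun=> @ord_max k.+1].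
Proof. by apply/forallP => v; rewrite ffunE /= ltnNge leqnSn. Qed.

Lemma kRoman_number_attained (T : finType) (e : rel T) (k : nat) :
  exists2 f : {ffun T -> 'I_k.+2},
    kRoman_dominating e f & weight f = kRoman_number e k.
Proof.
rewrite /kRoman_number; case: arg_minnP => [|f Hf _].
  exact: kRoman_dominating_max.
by exists f.
Qed.

Lemma kRoman_number_le (T : finType) (e : rel T) (k : nat)
    (f : {ffun T -> 'I_k.+2}) :
  kRoman_dominating e f -> kRoman_number e k <= weight f.
Proof.
rewrite /kRoman_number => Hf; case: arg_minnP => [|g _]; last exact.
exact: kRoman_dominating_max.
Qed.

Lemma cycle_adj_sym (m : nat) : symmetric (@cycle_adj m).
Proof. by move=> i j; rewrite /cycle_adj orbC. Qed.

Lemma cycle_adj_irr (m : nat) : 1 < m -> irreflexive (@cycle_adj m).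
Proof.
move=> m_gt1 i; rewrite /cycle_adj orbb -{1}[i : nat]addn0 eqn_modDl.
by rewrite mod0n modn_small.
Qed.

Lemma path_adj_sym (n : nat) : symmetric (@path_adj n).
Proof. by move=> i j; rewrite /path_adj orbC. Qed.

Lemma path_adj_irr (n : nat) : irreflexive (@path_adj n).
Proof. by move=> i; rewrite /path_adj orbb addn1 -[X in X == _]addn0 -addn1 eqn_add2l. Qed.

Lemma cartesian_adj_sym (T1 T2 : finType) (e1 : rel T1) (e2 : rel T2) :
  symmetric e1 -> symmetric e2 -> symmetric (cartesian_adj e1 e2).
Proof.
move=> s1 s2 x y.
by rewrite /cartesian_adj s1 s2 ![_ == y.1]eq_sym ![_ == y.2]eq_sym.
Qed.

Lemma cartesian_adj_irr (T1 T2 : finType) (e1 : rel T1) (e2 : rel T2) :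
  irreflexive e1 -> irreflexive e2 -> irreflexive (cartesian_adj e1 e2).
Proof. by move=> i1 i2 x; rewrite /cartesian_adj i1 i2 !andbF. Qed.

(* Main.v *)
Require Import Defs.
From mathcomp Require Import all_boot.
From mathcomp Require Import zify.

(** Label [k+1] the vertices of a 14-periodic pattern with one vertex [t] in
    column [2t] and two vertices [t+3], [t+5] in column [2t+1] (mod 7).  On the
    two-way infinite cylinder this set dominates everything.  Cutting out columns
    [0..n-1] leaves uncovered, in column [0], the rows [2] and [4], both adjacent
    to row [3], which gets one extra label [k+1]; and, in column [n-1], the rows
    of the pattern in the missing column [n], which get the label [k]. *)

(** A neighbour labelled [k.+1] pays for [k] and for its own count of 1; every other positive
    neighbour pays for its own count. *)
Lemma kRoman_dominating_strong_nbh (T : finType) (e : rel T) (k : nat)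
    (f : {ffun T -> 'I_k.+2}) :
  (forall v, f v < k -> exists2 u, e v u & f u = k.+1 :> nat) ->
  kRoman_dominating e f.
Proof.
move=> strong; apply/forallP => v; apply/implyP => /strong[w vw fw].
have vwN : w \in open_nbh e v by rewrite inE.
apply: (@leq_trans (\sum_(u in open_nbh e v) f u)); last first.
  rewrite [leqRHS](big_setID (open_nbh e v)) /=.
  by rewrite (setIidPr (subsetUr _ _)) leq_addr.
rewrite -sum1_card (eq_bigl (fun u => (u \in open_nbh e v) && (0 < f u))); last first.
  by move=> u; rewrite !inE.
rewrite big_mkcondr /= (bigD1 w vwN) [leqRHS](bigD1 w vwN) /= fw addnA addn1.
by rewrite leq_add2l leq_sum // => u _; case: (val (f u)).
Qed.

(** With [t = j./2], the rows [t + 3] and [t + 5] are written without subtraction as [i + 4] and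
    [i + 2] congruent to [t]. *)
Definition pattern (i j : nat) : bool :=
  if odd j then (i + 4 == j./2 %[mod 7]) || (i + 2 == j./2 %[mod 7])
  else i == j./2 %[mod 7].

Lemma pattern_period i j : pattern i (j + 14) = pattern i j.
Proof.
rewrite /pattern oddD addbF halfD andbF add0n.
by rewrite -[14./2]/7 modnDr.
Qed.

(** The offset [c] lets adjacent columns share one residue, so that domination becomes a finite
    check. *)
Lemma pattern_modn i j c : pattern i (j %% 14 + c) = pattern i (j + c).
Proof.
rewrite {2}(divn_eq j 14); elim: (j %/ 14) => [|q IHq]; first by rewrite mul0n.
by rewrite IHq -pattern_period; congr pattern; lia.
Qed.

Lemma pattern_card j : \sum_(i < 7) pattern i j = (odd j).+1.
Proof.
have jE i : pattern i j = pattern i (j %% 14) by rewrite -[j in LHS]addn0 -pattern_modn addn0.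
have -> : odd j = odd (j %% 14) by lia.
rewrite !big_ord_recr big_ord0 /= !jE; apply/eqP.
have: j %% 14 \in iota 0 14 by rewrite mem_iota /= ltn_pmod.
by move: (j %% 14); apply/allP.
Qed.

Definition strong (i j : nat) : bool := pattern i j || (i == 3) && (j == 0).

(** Row [i + 6] stands for row [i - 1]. The columns are unbounded on the right, so the right
    neighbour may lie in the missing column [n]. *)
Lemma strong_dominating i j : i < 7 ->
  [|| strong i j, strong (i.+1 %% 7) j, strong ((i + 6) %% 7) j,
      pattern i j.+1 | (0 < j) && pattern i j.-1].
Proof.
move=> lti7; have: i \in iota 0 7 by rewrite mem_iota.
case: j => [|j]; first by move: i {lti7}; apply/allP.
(* The column is now [j.+1]; it and its two neighbours have offsets 1, 0 and 2 from [j], leaving 14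
   residues times 7 rows. *)
have jE i' c : pattern i' (c + j) = pattern i' (c + j %% 14).
  by rewrite ![c + _]addnC pattern_modn.
rewrite /strong /= !andbF !orbF !(jE _ 1) (jE _ 2) (jE _ 0).
have: j %% 14 \in iota 0 14 by rewrite mem_iota /= ltn_pmod.
move: (j %% 14) => r rP; move: i {lti7}; apply/allP; move: r rP; apply/allP.
by vm_compute.
Qed.

Section Labelling.
Variables n k : nat.

Definition label (i j : nat) : nat :=
  if strong i j then k.+1 else if (j.+1 == n) && pattern i n then k else 0.

Definition labelling : {ffun 'I_7 * 'I_n -> 'I_k.+2} :=
  [ffun v : 'I_7 * 'I_n => inord (label v.1 v.2)].

Lemma labellingE (v : 'I_7 * 'I_n) : labelling v = label v.1 v.2 :> nat.
Proof. by rewrite ffunE inordK // /label; do 2![case: ifP => _ //]; lia. Qed.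

Lemma labelling_dominating :
  kRoman_dominating (cartesian_adj (@cycle_adj 7) (@path_adj n)) labelling.
Proof.
apply: kRoman_dominating_strong_nbh => -[i j]; rewrite labellingE /= => weak.
have strongE (u : 'I_7 * 'I_n) : strong u.1 u.2 -> labelling u = k.+1 :> nat.
  by rewrite labellingE /label => ->.
have ltj := ltn_ord j.
have mod7 a : a %% 7 < 7 by rewrite ltn_pmod.
have cyc a : @cycle_adj 7 i (Ordinal (mod7 a)) = (a == i + 1 %[mod 7]) || (i == a + 1 %[mod 7]).
  by rewrite /cycle_adj /= modn_mod modnDml.
case/or4P: (strong_dominating i j (ltn_ord i)) => [s | s | s | /orP[s | /andP[j0 s]]].
- by move: weak; rewrite /label s; lia.
- exists (Ordinal (mod7 i.+1), j); last exact: strongE.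
  by rewrite /cartesian_adj /= cyc eqxx addn1 eqxx orbT.
- exists (Ordinal (mod7 (i + 6)), j); last exact: strongE.
  by rewrite /cartesian_adj /= cyc eqxx -addnA modnDr eqxx !orbT.
- have [ltjn | jn] := ltnP j.+1 n.
    exists (i, Ordinal ltjn); last by apply: strongE; rewrite /strong s.
    by rewrite /cartesian_adj /path_adj /= eqxx addn1 eqxx.
  (* The dominating vertex would lie in column [n], so the vertex itself has label at least [k],
     against [weak]. *)
  have jnE : j.+1 = n by lia.
  by move: s weak; rewrite /label jnE eqxx => -> /=; case: ifP => _; lia.
have ltjn : j.-1 < n by lia.
exists (i, Ordinal ltjn); last by apply: strongE; rewrite /strong s.
by rewrite /cartesian_adj /path_adj /= eqxx !addn1 prednK // eqxx orbT.
Qed.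

Lemma weight_labelling :
  weight labelling <= (n + n./2).+1 * k.+1 + (odd n).+1 * k.
Proof.
(* The three sources of a label are added up; overlaps only enlarge the bound. *)
pose bound i j := pattern i j * k.+1 + ((i == 3) && (j == 0)) * k.+1
                  + ((j.+1 == n) && pattern i n) * k.
have single a : \sum_(j < n) (j == a :> nat) <= 1.
  have [lta | lea] := ltnP a n; last first.
    by rewrite big1 // => j _; have := ltn_ord j; case: eqP => //; lia.
  rewrite (bigD1 (Ordinal lta)) //= eqxx big1 // => j /negPf.
  by rewrite -val_eqE /= => ->.
apply: (@leq_trans (\sum_(j < n) \sum_(i < 7) bound i j)).
  rewrite exchange_big pair_bigA /=; apply: leq_sum => -[i j] _ /=.
  rewrite labellingE /label /bound /strong /=.
  by case: (pattern i j); case: (_ && (_ == 0)); case: (_ && pattern _ _) => /=; lia.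
have col (j : 'I_n) : \sum_(i < 7) bound i j =
    (odd j).+1 * k.+1 + (j == 0 :> nat) * k.+1 + (j == n.-1 :> nat) * ((odd n).+1 * k).
  rewrite /bound !big_split /= -!big_distrl /= pattern_card; congr (_ + _ + _).
    by rewrite !big_ord_recr big_ord0 /=; case: (_ == 0).
  have -> : (j.+1 == n) = (j == n.-1 :> nat) by have := ltn_ord j; lia.
  by case: (_ == _); rewrite ?pattern_card ?mul1n //= big1.
rewrite (eq_bigr _ (fun j _ => col j)) !big_split /= -!big_distrl /=.
have -> : \sum_(j < n) (odd j).+1 = n + n./2.
  by elim: (n) => [|m IHm]; rewrite ?big_ord0 // big_ord_recr /= IHm; lia.
rewrite (mulSnr (_ + _)); apply: leq_add; last by rewrite -[leqRHS]mul1n leq_mul2r single orbT.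
by rewrite leq_add2l -[leqRHS]mul1n leq_mul2r single orbT.
Qed.

End Labelling.

Theorem theorem14 (n k : nat) (hn : 2 <= n) (hk : 1 <= k) :
  kRoman_number (cartesian_adj (@cycle_adj 7) (@path_adj n)) k <=
    if odd n then n.+1 * k.+1 + (n.-1)./2 * k.+1 + 2 * k
    else n * k.+1 + n./2 * k.+1 + 2 * k + 1.
Proof.
apply: leq_trans (kRoman_number_le (labelling_dominating n k)) _.
apply: leq_trans (weight_labelling n k) _.
(* For even [n] the extra labels are one [k.+1] and one [k], together [2 * k + 1]; for odd [n], one
   [k.+1] and two [k]. *)
case: ifP => odd_n; last by lia.
have -> : n.-1./2 = n./2 by lia.
lia.
Qed.
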